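(* For pointed Kan complexes $(K,\star)$ and pointed Kan pairs $(K,L,\star)$: (a) $\pi_n(K,\star)$ is a well-defined set for $n\ge 0$, and $\pi_n(K,L,\star)$ is a well-defined set for $n\ge 1$. (b) The composition $[x][y]=[xy]$ is well defined and makes $\pi_n(K,\star)$ a group for $n\ge 1$ and $\pi_n(K,L,\star)$ a group for $n\ge 2$. (c) The group $\pi_n(K,\star)$ is abelian for $n\ge 2$, and $\pi_n(K,L,\star)$ is abelian for $n\ge 3$. (d) The assignments $(K,\star)\mapsto\pi_n(K,\star)$ and $(K,L,\star)\mapsto\pi_n(K,L,\star)$ are functorial, with $f_*[x]=[f(x)]$ for a simplicial map $f$ of pointed Kan complexes (respectively pointed Kan pairs); the maps $f_*$ are group homomorphisms whenever the homotopy sets are groups by (b).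
   Context: For a simplicial set $K$ with face maps $d_i$ and degeneracy maps $s_i$, write $\partial x=(d_0x,\dots,d_nx)$ for $x\in K_n$. A tuple $(x_0,\dots,x_{n+1})$ of $n$-simplices is an $n$-cycle if $d_ix_j=d_{j-1}x_i$ for all $0\le i<j\le n+1$; it is a boundary (''is filled'') if it equals $\partial x$ for some $(n+1)$-simplex $x$. An $(n,k)$-horn is such a tuple with the $k$-th entry left unspecified, satisfying the same relations among the other entries. Completing a horn means choosing an $n$-simplex for the missing entry such that the resulting tuple is a boundary. A Kan complex is a simplicial set in which every horn is the horn of some $(n+1)$-simplex (equivalently, every horn can be completed). Conditions on faces of $0$-simplices are vacuous. A pointed Kan complex $(K,\star)$ is a Kan complex with a base point $\star\in K_0$; its degenerate images in each dimension are also denoted $\star$. A pointed Kan pair $(K,L,\star)$ consists of Kan complexes $L\subset K$ with $L$ a simplicial subset and $\star\in L_0$. Maps of pointed complexes/pairs are simplicial maps preserving base point and subcomplex. Homotopy: $x,y\in K_n$ with $\partial x=\partial y$ satisfy $x\sim y$ if $(s_{n-1}d_0x,\dots,s_{n-1}d_{n-1}x,x,y)$ is filled. Relative homotopy ($n\ge1$): $x\sim_{\mathrm{rel}L}y$ if $d_ix=d_iy$ for $1\le i\le n$, $d_0x,d_0y\in L_{n-1}$, and for some $h_L\in L_n$ the tuple $(h_L,s_{n-1}d_1x,\dots,s_{n-1}d_{n-1}x,x,y)$ is a cycle filled by some simplex of $K_{n+1}$. Homotopy groups: $\pi_n(K,\star)=\{x\in K_n:\partial x=(\star,\dots,\star)\}/\!\sim$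 for $n\ge 0$; for $n\ge1$, $[x][y]=[xy]$ where $xy\in K_n$ is any simplex such that $(\star,\dots,\star,y,xy,x)$ is filled. For $n\ge 1$, $\pi_n(K,L,\star)=\{x\in K_n:\partial x=(l,\star,\dots,\star),\ l\in L_{n-1}\}/\!\sim_{\mathrm{rel}L}$; for $n\ge2$, $[x][y]=[xy]$ where $xy\in K_n$ (representing an element of $\pi_n(K,L,\star)$) is such that $(h,\star,\dots,\star,y,xy,x)$ is filled in $K$ for some $h\in L_n$. ''Well-defined set'' means that the relation being divided out is an equivalence relation on the given set of representatives. *)

(* Defs.v *)
From mathcomp Require Export all_boot.
From mathcomp Require Import classical_sets.
From Stdlib Require Export RelationClasses.

Set Implicit Arguments.
Unset Strict Implicit.
Unset Printing Implicit Defensive.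

(* [face n i] and [degen n i] are indexed by all natural numbers [i]; only the
   values at [i <= n.+1] (resp. [i <= n]) are meaningful, and only those are
   ever constrained or used below. *)
Record sset := SSet {
  simplex :> nat -> Type;
  face : forall n, nat -> simplex n.+1 -> simplex n;
  degen : forall n, nat -> simplex n -> simplex n.+1;
  face_face : forall n i j (x : simplex n.+2), i < j <= n.+2 ->
    face i (face j x) = face j.-1 (face i x);
  face_degen_lt : forall n i j (x : simplex n.+1), i < j <= n.+1 ->
    face i (degen j x) = degen j.-1 (face i x);
  face_degen_eq : forall n j (x : simplex n), j <= n ->
    face j (degen j x) = x;
  face_degen_succ : forall n j (x : simplex n), j <= n ->
    face j.+1 (degen j x) = x;
  face_degen_gt : forall n i j (x : simplex n.+1), j.+1 < i <= n.+2 ->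
    face i (degen j x) = degen j (face i.-1 x);
  degen_degen : forall n i j (x : simplex n), i <= j <= n ->
    degen i (degen j x) = degen j.+1 (degen i x)
}.

Arguments face {s n} i x : rename.
Arguments degen {s n} i x : rename.

Record smap (K K' : sset) := SMap {
  sfun :> forall n, K n -> K' n;
  sfun_face : forall n i (x : K n.+1), i <= n.+1 ->
    sfun (face i x) = face i (sfun x);
  sfun_degen : forall n i (x : K n), i <= n ->
    sfun (degen i x) = degen i (sfun x)
}.

Arguments sfun {K K'} s {n} x : rename.

Definition smap_id (K : sset) : smap K K :=
  @SMap K K (fun n x => x) (fun _ _ _ _ => erefl) (fun _ _ _ _ => erefl).

Lemma smap_comp_face K K' K'' (g : smap K' K'') (f : smap K K') n i
  (x : K n.+1) : i <= n.+1 -> g _ (f _ (face i x)) = face i (g _ (f _ x)).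
Proof. by move=> le_i; rewrite !sfun_face. Qed.

Lemma smap_comp_degen K K' K'' (g : smap K' K'') (f : smap K K') n i
  (x : K n) : i <= n -> g _ (f _ (degen i x)) = degen i (g _ (f _ x)).
Proof. by move=> le_i; rewrite !sfun_degen. Qed.

Definition smap_comp K K' K'' (g : smap K' K'') (f : smap K K') :
    smap K K'' :=
  @SMap K K'' (fun n x => g n (f n x))
    (smap_comp_face g f) (smap_comp_degen g f).

(* A tuple (x_0, ..., x_{n+1}) of n-simplices is a function [t : nat -> K n],
   of which only the values at [i <= n.+1] matter. *)

(* The relations d_i x_j = d_{j-1} x_i (i < j) among the entries with index in
   [A]; vacuous for 0-simplices. *)
Definition compatible (K : sset) (A : pred nat) n : (nat -> K n) -> Prop :=
  match n with
  | 0 => fun _ => True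
  | m.+1 => fun t => forall i j, i < j <= m.+2 -> A i -> A j ->
      face i (t j) = face j.-1 (t i)
  end.

Definition is_cycle (K : sset) n (t : nat -> K n) : Prop :=
  compatible predT t.

(* The value [t k] is irrelevant. *)
Definition is_horn (K : sset) n (k : nat) (t : nat -> K n) : Prop :=
  compatible (predC1 k) t.

Definition filled (K : sset) n (t : nat -> K n) : Prop :=
  exists w : K n.+1, forall i, i <= n.+1 -> face i w = t i.

Definition same_boundary (K : sset) n : K n -> K n -> Prop :=
  match n with
  | 0 => fun _ _ => True
  | m.+1 => fun x y => forall i, i <= m.+1 -> face i x = face i y
  end.

Definition is_subcomplex (K : sset) (L : forall n, set (K n)) : Prop :=
  (forall n i (x : K n.+1), i <= n.+1 -> L n.+1 x -> L n (face i x)) /\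
  (forall n i (x : K n), i <= n -> L n x -> L n.+1 (degen i x)).

(* The simplicial subset [L] of [K] is a Kan complex. *)
Definition kan_on (K : sset) (L : forall n, set (K n)) : Prop :=
  forall n k (t : nat -> K n), k <= n.+1 ->
    (forall i, i <= n.+1 -> i != k -> L n (t i)) -> is_horn k t ->
    exists2 w : K n.+1, L n.+1 w &
      forall i, i <= n.+1 -> i != k -> face i w = t i.

Definition kan (K : sset) : Prop := kan_on (fun n => [set: K n]%classic).

Record pkan := PKan {
  pkan_sset :> sset;
  base : pkan_sset 0;
  pkan_kan : kan pkan_sset
}.

Record pkan_map (K K' : pkan) := PKanMap {
  pkan_map_smap :> smap K K';
  pkan_map_base : pkan_map_smap 0 (base K) = base K'
}.

Definition pkan_id (K : pkan) : pkan_map K K :=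
  @PKanMap K K (smap_id K) erefl.

Lemma pkan_comp_base (K K' K'' : pkan) (g : pkan_map K' K'')
  (f : pkan_map K K') : smap_comp g f 0 (base K) = base K''.
Proof. by rewrite /= !pkan_map_base. Qed.

Definition pkan_comp (K K' K'' : pkan) (g : pkan_map K' K'')
    (f : pkan_map K K') : pkan_map K K'' :=
  PKanMap (pkan_comp_base g f).

Record pkan_pair := PKanPair {
  pair_pkan :> pkan;
  sub : forall n, set (pair_pkan n);
  sub_subcomplex : is_subcomplex sub;
  sub_kan : kan_on sub;
  sub_base : sub (base pair_pkan)
}.

Arguments sub P {n} : rename.

Record pair_map (P P' : pkan_pair) := PairMap {
  pair_map_pkan :> pkan_map P P';
  pair_map_sub : forall n (x : P n), sub P x -> sub P' (pair_map_pkan n x)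
}.

Definition pair_id (P : pkan_pair) : pair_map P P :=
  @PairMap P P (pkan_id P) (fun _ _ Lx => Lx).

Definition pair_comp (P P' P'' : pkan_pair) (g : pair_map P' P'')
    (f : pair_map P P') : pair_map P P'' :=
  @PairMap P P'' (pkan_comp g f)
    (fun n x Lx => pair_map_sub g (pair_map_sub f Lx)).

(* The degenerate image of the base point in dimension [n]. *)
Fixpoint pt (K : pkan) n : K n :=
  match n with
  | 0 => base K
  | m.+1 => degen 0 (pt K m)
  end.

(* s_{n-1} d_i x; the case [n = 0] never occurs in the tuples below. *)
Definition degen_face (K : sset) n (i : nat) : K n -> K n :=
  match n with
  | 0 => fun x => x
  | m.+1 => fun x => degen m (face i x)
  end.

(* (s_{n-1} d_0 x, ..., s_{n-1} d_{n-1} x, x, y) *)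
Definition htpy_tuple (K : sset) n (x y : K n) (i : nat) : K n :=
  if i < n then degen_face i x else if i == n then x else y.

Definition homotopic (K : sset) n (x y : K n) : Prop :=
  same_boundary x y /\ filled (htpy_tuple x y).

(* (h, s_{n-1} d_1 x, ..., s_{n-1} d_{n-1} x, x, y), for n >= 1 *)
Definition rel_htpy_tuple (K : sset) n (h x y : K n) (i : nat) : K n :=
  if i == 0 then h else htpy_tuple x y i.

(* Relative notions are only meaningful for n >= 1; the value at [n = 0] of
   the next definition and of [rel_sphere] is a placeholder. *)
Definition rel_homotopic (P : pkan_pair) n : P n -> P n -> Prop :=
  match n with
  | 0 => fun _ _ => False
  | m.+1 => fun x y =>
      [/\ forall i, 1 <= i <= m.+1 -> face i x = face i y,
          sub P (face 0 x),
          sub P (face 0 y) &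
          exists2 h, sub P h &
            is_cycle (rel_htpy_tuple h x y) /\ filled (rel_htpy_tuple h x y)]
  end.

(* The set of classes {y | R x y} of a relation [R]; this makes sense for any
   relation, and is the usual quotient when [R] is an equivalence. *)
Definition quot (T : Type) (R : T -> T -> Prop) : Type :=
  {A : set T | exists x, A = R x}.

Definition class (T : Type) (R : T -> T -> Prop) (x : T) : quot R :=
  exist _ (R x) (ex_intro _ x erefl).

Definition sphere (K : pkan) n : K n -> Prop :=
  match n with
  | 0 => fun _ => True
  | m.+1 => fun x => forall i, i <= m.+1 -> face i x = pt K m
  end.

Definition sphere_type (K : pkan) n : Type := {x : K n | sphere x}.

Definition sphere_htpy (K : pkan) n (x y : sphere_type K n) : Prop :=
  homotopic (sval x) (sval y).

Definition pi (K : pkan) n : Type := quot (@sphere_htpy K n).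

Definition pi_class (K : pkan) n (x : K n) (hx : sphere x) : pi K n :=
  class (@sphere_htpy K n) (exist _ x hx).

Definition rel_sphere (P : pkan_pair) n : P n -> Prop :=
  match n with
  | 0 => fun _ => False
  | m.+1 => fun x =>
      sub P (face 0 x) /\ forall i, 1 <= i <= m.+1 -> face i x = pt P m
  end.

Definition rel_sphere_type (P : pkan_pair) n : Type :=
  {x : P n | rel_sphere x}.

Definition rel_sphere_htpy (P : pkan_pair) n (x y : rel_sphere_type P n) :
    Prop :=
  rel_homotopic (sval x) (sval y).

Definition rel_pi (P : pkan_pair) n : Type := quot (@rel_sphere_htpy P n).

Definition rel_pi_class (P : pkan_pair) n (x : P n) (hx : rel_sphere x) :
    rel_pi P n :=
  class (@rel_sphere_htpy P n) (exist _ x hx).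

(* ( *, ..., *, y, z, x), for n >= 1 *)
Definition comp_tuple (K : pkan) n (x y z : K n) (i : nat) : K n :=
  if i == n.+1 then x else if i == n then z
  else if i.+1 == n then y else pt K n.

(* [z] is a possible choice of xy. *)
Definition composite (K : pkan) n (x y z : K n) : Prop :=
  filled (comp_tuple x y z).

(* (h, *, ..., *, y, z, x), for n >= 2 *)
Definition rel_comp_tuple (K : pkan) n (h x y z : K n) (i : nat) : K n :=
  if i == 0 then h else comp_tuple x y z i.

Definition rel_composite (P : pkan_pair) n (x y z : P n) : Prop :=
  rel_sphere z /\
  exists2 h, sub P h & filled (rel_comp_tuple h x y z).

(* [op] is the operation [x][y] = [xy], for every choice of representatives
   [x], [y] and of the composite xy. *)
Definition is_composition (K : pkan) n (op : pi K n -> pi K n -> pi K n) :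
    Prop :=
  forall (x y z : K n) (hx : sphere x) (hy : sphere y), composite x y z ->
    exists hz : sphere z, op (pi_class hx) (pi_class hy) = pi_class hz.

Definition is_rel_composition (P : pkan_pair) n
    (op : rel_pi P n -> rel_pi P n -> rel_pi P n) : Prop :=
  forall (x y z : P n) (hx : rel_sphere x) (hy : rel_sphere y),
    rel_composite x y z -> exists hz : rel_sphere z,
      op (rel_pi_class hx) (rel_pi_class hy) = rel_pi_class hz.

Definition is_group (T : Type) (op : T -> T -> T) : Prop :=
  exists (e : T) (inv : T -> T),
    [/\ associative op, left_id e op, right_id e op,
        left_inverse e inv op & right_inverse e inv op].

(* [F] is the map f_* [x] = [f x], for every representative [x]. *)
Definition is_induced (K K' : pkan) (f : pkan_map K K') n
    (F : pi K n -> pi K' n) : Prop :=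
  forall (x : K n) (hx : sphere x),
    exists hfx : sphere (f n x), F (pi_class hx) = pi_class hfx.

Definition is_rel_induced (P P' : pkan_pair) (f : pair_map P P') n
    (F : rel_pi P n -> rel_pi P' n) : Prop :=
  forall (x : P n) (hx : rel_sphere x),
    exists hfx : rel_sphere (f n x), F (rel_pi_class hx) = rel_pi_class hfx.

(* Main.v *)
Require Import Defs.
From mathcomp Require Import boolp classical_sets.

Set Implicit Arguments.
Unset Strict Implicit.
Unset Printing Implicit Defensive.

(** Everything rests on one consequence of the Kan condition, [filled_row]: if
    the tuples [a_0, ..., a_{n+2}] of n-simplices match like the boundaries of
    the faces of an (n+2)-simplex and all but one of them are filled, so is the
    last one.  When all entries with small row or column index are the base
    point ([filled_block]), only a small table is left, which looks the same in
    every dimension.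

    With rows of length 3, a filled row [(y, z, x)] says that [z] is a composite
    xy, and the table is that of a tetrahedron with edges [e_ij]: three of the
    four relations [e_ij e_jk = e_ik] imply the fourth ([tetra1], [tetra2]).
    A homotopy from [x] to [y] says that [x] is a composite of [y] with the base
    point ([homotopic_composite]), so that transitivity, symmetry, independence
    of representatives and associativity are all instances of the tetrahedron.

    With rows of length 4, available for n > 1, the table is that of a 4-simplex
    ([pentatope0], [pentatope2]), and it turns a filler for xy into one for yx
    ([composite_comm]).

    The relative case is not proved separately.  The (n+1)-simplices [x] of [K]
    with [d_0 x] in [L], with the face and degeneracy maps of positive index,
    are the n-simplices of a Kan complex ([dec_pkan]), namely the disjoint union
    of the homotopy fibres of the inclusion of [L] over all vertices of [K].
    Spheres (for n > 0), homotopies and composites of dimension n there are the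
    relative ones of dimension n+1 in [K] ([sphere_dec], [rel_sphere_dec],
    [rel_homotopic_dec], [composite_dec]).  This shift by one is the reason why
    each bound on n increases by one in the relative statements.

    Finally, quotients are treated once for all, for a set of representatives
    with an equivalence relation and a composition relation. *)

(** * Base points, spheres and fillers *)

Lemma face_pt (K : pkan) n i : i <= n.+1 -> face i (pt K n.+1) = pt K n.
Proof.
elim: n i => [|n IHn] [|[|i]] //= le_i; rewrite ?face_degen_eq //.
- by rewrite face_degen_succ.
- by rewrite face_degen_succ.
- by rewrite face_degen_gt // IHn.
Qed.

Lemma degen_pt (K : pkan) n i : i <= n -> degen i (pt K n) = pt K n.+1.
Proof.
elim: n i => [|n IHn] [|i] //= le_i.
by rewrite -degen_degen // -/(pt K n.+1) IHn.
Qed.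

Lemma sphere_pt (K : pkan) n : sphere (pt K n).
Proof. by case: n => // n i le_i; rewrite face_pt. Qed.

Lemma filled_ext (K : sset) n (t u : nat -> K n) :
  (forall i, i <= n.+1 -> t i = u i) -> filled t -> filled u.
Proof. by move=> tu [w wE]; exists w => i le_i; rewrite wE // tu. Qed.

Lemma filled_cycle (K : sset) n (t : nat -> K n) : filled t -> is_cycle t.
Proof.
case: n t => // n t [w wE] i j /andP[lt_ij le_j] _ _.
by rewrite -!wE ?(leq_trans (ltnW lt_ij)) // face_face ?lt_ij.
Qed.

(** The fillers of the rows other than [k] form a horn in dimension n+1; the
    missing face of a filler of this horn fills row [k]. *)
Lemma filled_row (K : pkan) n (a : nat -> nat -> K n) k : k <= n.+2 ->
    (forall i j, i < j <= n.+2 -> a j i = a i j.-1) ->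
    (forall i, i <= n.+2 -> i != k -> filled (a i)) ->
  filled (a k).
Proof.
move=> le_k aE fill_a.
have /choice[w wE] i : exists w : K n.+1,
    i <= n.+2 -> i != k -> forall j, j <= n.+1 -> face j w = a i j.
  have [le_i|gt_i] := leqP i n.+2; last by exists (degen 0 (a 0 0)).
  have [->|ne_i] := eqVneq i k; first by exists (degen 0 (a 0 0)).
  by have [w wE] := fill_a i le_i ne_i; exists w.
have horn_w : is_horn k w.
  move=> i j /andP[lt_ij le_j] /= ne_i ne_j.
  have le_i : i <= n.+1 by rewrite -ltnS (leq_trans lt_ij).
  have le_j1 : j.-1 <= n.+1 by case: (j) le_j.
  by rewrite (wE j) // (wE i) ?(leqW le_i) // (aE i j) // lt_ij.
have [W _ WE] := pkan_kan le_k (fun _ _ _ => I) horn_w.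
exists (face k W) => j le_j; have [lt_jk|le_kj] := ltnP j k.
- have le_jn : j <= n.+2 by apply: leqW.
  have le_k1 : k.-1 <= n.+1 by case: (k) le_k.
  rewrite face_face ?lt_jk // WE ?ltn_eqF // wE ?ltn_eqF //.
  by rewrite (aE j k) // lt_jk.
- have := @face_face K n k j.+1 W; rewrite ltnS le_kj ltnS => /(_ le_j) /= <-.
  rewrite WE ?gtn_eqF // wE ?gtn_eqF ?(leq_trans le_kj) //.
  by rewrite (aE k j.+1) // ltnS le_kj.
Qed.

(** The tuple with [m] base points followed by [s], the shape of all tuples
    that occur in the homotopy groups. *)
Definition pad (K : pkan) n m (s : seq (K n)) : nat -> K n :=
  nth (pt K n) (nseq m (pt K n) ++ s).

Lemma padE (K : pkan) n m (s : seq (K n)) i :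
  pad m s i = if i < m then pt K n else nth (pt K n) s (i - m).
Proof. by rewrite /pad nth_cat size_nseq nth_nseq; case: ltnP. Qed.

(** [M] lists the last rows of the table of [filled_row], without their first
    [m] entries; the other rows are constant and hence filled by a base
    point. *)
Lemma filled_block (K : pkan) n m (M : seq (seq (K n))) k :
    m <= n.+2 -> k <= n.+2 - m ->
    (forall i j, i < j <= n.+2 - m ->
      nth (pt K n) (nth [::] M j) i = nth (pt K n) (nth [::] M i) j.-1) ->
    (forall i, i <= n.+2 - m -> i != k -> filled (pad m (nth [::] M i))) ->
  filled (pad m (nth [::] M k)).
Proof.
move=> le_m le_k ME fillM.
pose a i := if i < m then fun=> pt K n else pad m (nth [::] M (i - m)).
have -> : pad m (nth [::] M k) = a (m + k).
  by rewrite /a ltnNge leq_addr /= addKn.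
apply: filled_row => [|i j /andP[lt_ij le_j]|i le_i ne_i].
- by rewrite -leq_subRL.
- rewrite /a; have [lt_jm|le_mj] := ltnP j m; first
    by rewrite (ltn_trans lt_ij).
  rewrite padE; have [//|le_mi] := ltnP i m.
  have lt_mj : m < j by apply: leq_ltn_trans lt_ij.
  rewrite padE ME ?ltn_sub2r ?leq_sub2r //.
  have le_mj1 : m <= j.-1 by case: (j) lt_mj.
  by rewrite ltnNge le_mj1 -!subn1 subnAC.
- rewrite /a; have [_|le_mi] := ltnP i m.
    by exists (pt K n.+1) => j le_j; rewrite face_pt.
  apply: fillM; first by rewrite leq_sub2r.
  by rewrite -(eqn_add2l m) subnKC.
Qed.

Lemma sphere_face (K : pkan) n (w : K n.+2) k : k <= n.+2 ->
    (forall i, i <= n.+2 -> i != k -> sphere (face i w)) ->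
  sphere (face k w).
Proof.
move=> le_k sph_w j le_j; have [lt_jk|le_kj] := ltnP j k.
- rewrite face_face ?lt_jk // sph_w ?ltn_eqF ?(leq_trans (ltnW lt_jk)) //.
  by case: (k) lt_jk le_k.
- have := @face_face K n k j.+1 w; rewrite ltnS le_kj ltnS => /(_ le_j) /= <-.
  by rewrite sph_w ?gtn_eqF // (leq_trans le_kj).
Qed.

(** A tuple of spheres satisfies every horn relation, as all the faces involved
    are the base point. *)
Lemma sphere_horn (K : pkan) n (t : nat -> K n.+1) k : k <= n.+2 ->
    (forall i, i <= n.+2 -> i != k -> sphere (t i)) ->
  exists2 z, sphere z & filled (fun i => if i == k then z else t i).
Proof.
move=> le_k sph_t.
have horn_t : is_horn k t.
  move=> i j /andP[lt_ij le_j] ne_i ne_j.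
  have le_i : i <= n.+1 by rewrite -ltnS (leq_trans lt_ij).
  rewrite !sph_t ?(leqW le_i) //.
  by case: (j) lt_ij le_j.
have [w _ wE] := pkan_kan le_k (fun _ _ _ => I) horn_t.
exists (face k w).
  by apply: sphere_face => // i le_i ne_i; rewrite wE //; apply: sph_t.
by exists w => i le_i; case: eqP => [->//|/eqP ne_i]; rewrite wE.
Qed.

(** * Composition as a relation between spheres *)

Lemma composite_pad (K : pkan) n (x y z : K n.+1) :
  composite x y z <-> filled (pad n [:: y; z; x]).
Proof.
have E i : i <= n.+2 -> comp_tuple x y z i = pad n [:: y; z; x] i.
  move=> le_i; rewrite padE /comp_tuple eqSS; have [lt_in|le_ni] := ltnP i n.
    by rewrite !ltn_eqF // ltnW // ltnW.
  move: le_i; rewrite -(subnKC le_ni) addKn.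
  case: (i - n) => [|[|[|d]]] /=.
  - by rewrite addn0 ?eqxx !ltn_eqF // ltnW.
  - by rewrite addn1 eqxx ltn_eqF.
  - by rewrite addn2 eqxx.
  - by rewrite -[n.+2]addn2 leq_add2l.
by split; apply: filled_ext => i le_i; rewrite E.
Qed.

Section Tetrahedron.
Variables (K : pkan) (n : nat).
Variables e01 e02 e03 e12 e13 e23 : K n.+1.

(* Row [i] lists the edges of the face opposite to the vertex [i]. *)
Let edges :=
  [:: [:: e23; e13; e12]; [:: e23; e03; e02]; [:: e13; e03; e01];
      [:: e12; e02; e01]].

Let edgesE i j : i < j <= n.+3 - n ->
  nth (pt K n.+1) (nth [::] edges j) i =
  nth (pt K n.+1) (nth [::] edges i) j.-1.
Proof.
rewrite -addn3 addKn.
by case/andP; case: i j => [|[|[|i]]] [|[|[|[|j]]]].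
Qed.

Lemma tetra1 : composite e12 e23 e13 -> composite e01 e13 e03 ->
  composite e01 e12 e02 -> composite e02 e23 e03.
Proof.
move=> /composite_pad c0 /composite_pad c2 /composite_pad c3.
apply/composite_pad; apply: (@filled_block _ _ n edges 1) => //.
- by rewrite -addn3 leq_addr.
- by rewrite -addn3 addKn.
- by rewrite -addn3 addKn => -[|[|[|[|i]]]].
Qed.

Lemma tetra2 : composite e12 e23 e13 -> composite e02 e23 e03 ->
  composite e01 e12 e02 -> composite e01 e13 e03.
Proof.
move=> /composite_pad c0 /composite_pad c2 /composite_pad c3.
apply/composite_pad; apply: (@filled_block _ _ n edges 2) => //.
- by rewrite -addn3 leq_addr.
- by rewrite -addn3 addKn.
- by rewrite -addn3 addKn => -[|[|[|[|i]]]].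
Qed.

End Tetrahedron.

Section Composites.
Variables (K : pkan) (n : nat).
Local Notation pt := (pt K n.+1).
Implicit Types x y z u v w : K n.+1.

Lemma composite1x x : sphere x -> composite pt x x.
Proof.
move=> sph_x; apply/composite_pad; exists (degen n x) => i le_i.
rewrite padE; have [lt_in|le_ni] := ltnP i n.
  case: n x sph_x lt_in le_i => // m x sph_x lt_im le_i.
  by rewrite face_degen_lt ?lt_im ?leqnSn // sph_x ?degen_pt // ltnW // ltnW.
move: le_i; rewrite -(subnKC le_ni) addKn.
case: (i - n) => [|[|[|d]]] /=.
- by rewrite addn0 face_degen_eq.
- by rewrite addn1 face_degen_succ.
- by rewrite addn2 face_degen_gt ?leqnn // sph_x // degen_pt.
- by rewrite -[n.+2]addn2 leq_add2l.
Qed.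

Lemma compositex1 x : sphere x -> composite x pt x.
Proof.
move=> sph_x; apply/composite_pad; exists (degen n.+1 x) => i le_i.
rewrite padE; have [lt_in|le_ni] := ltnP i n.
  have le_i1 : i <= n.+1 by rewrite leqW // ltnW.
  by rewrite face_degen_lt ?ltnS ?(ltnW lt_in) ?leqnn //= sph_x ?degen_pt.
move: le_i; rewrite -(subnKC le_ni) addKn.
case: (i - n) => [|[|[|d]]] /=.
- by rewrite addn0 face_degen_lt ?leqnn // sph_x ?degen_pt.
- by rewrite addn1 face_degen_eq.
- by rewrite addn2 face_degen_succ.
- by rewrite -[n.+2]addn2 leq_add2l.
Qed.

(** The horn relation for the three entries [y], [z], [x] of [comp_tuple];
    completing it at [k] multiplies two spheres or divides one by the other. *)
Lemma composite_horn k x y z : n <= k <= n.+2 ->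
    (n != k -> sphere y) -> (n.+1 != k -> sphere z) ->
    (n.+2 != k -> sphere x) ->
  exists2 u, sphere u & composite (if k == n.+2 then u else x)
    (if k == n then u else y) (if k == n.+1 then u else z).
Proof.
move=> /andP[le_nk le_k] sy sz sx.
have [i le_i ne_i|u sph_u fill_u] := @sphere_horn K n (comp_tuple x y z) k le_k.
  rewrite /comp_tuple eqSS.
  case: eqP => [ei|_]; first by apply: sx; rewrite -ei.
  case: eqP => [ei|_]; first by apply: sz; rewrite -ei.
  case: eqP => [ei|_]; first by apply: sy; rewrite -ei.
  exact: sphere_pt.
exists u => //; apply: filled_ext fill_u => i le_i.
rewrite /comp_tuple eqSS; have [->|/negPf ne_i] := eqVneq i k.
  have [//|ne2] := eqVneq k n.+2; have [//|ne1] := eqVneq k n.+1.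
  by rewrite eqn_leq le_nk -ltnS ltn_neqAle ne1 -ltnS ltn_neqAle ne2 le_k.
have neF m : i = m -> (k == m) = false by move=> <-; rewrite eq_sym.
by do 3![case: eqP => [/neF -> //|_]].
Qed.

Lemma composite_ex x y : sphere x -> sphere y ->
  exists2 z, sphere z & composite x y z.
Proof.
move=> sx sy; have [||||z] := @composite_horn n.+1 x y pt => //.
- by rewrite !leqnSn.
- by rewrite eqxx.
- by rewrite ltn_eqF // gtn_eqF // eqxx; exists z.
Qed.

Lemma composite_rinv x : sphere x -> exists2 y, sphere y & composite x y pt.
Proof.
move=> sx; have [||||y] := @composite_horn n x pt pt => //.
- by rewrite leqnn ltnW.
- by rewrite eqxx.
- by move=> _; apply: sphere_pt.
- by rewrite eqxx !ltn_eqF //; exists y.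
Qed.

Lemma composite_linv x : sphere x -> exists2 y, sphere y & composite y x pt.
Proof.
move=> sx; have [||||y] := @composite_horn n.+2 pt x pt => //.
- by rewrite leqnn ltnW.
- by move=> _; apply: sphere_pt.
- by rewrite eqxx.
- by rewrite eqxx !gtn_eqF //; exists y.
Qed.

Lemma composite_sphere x y z : sphere x -> sphere y -> composite x y z ->
  sphere z.
Proof.
move=> sx sy [w wE].
have -> : z = face n.+1 w by rewrite wE // /comp_tuple ltn_eqF // eqxx.
apply: sphere_face => // i le_i ne_i; rewrite wE // /comp_tuple (negPf ne_i).
by do 2!case: ifP => // _; apply: sphere_pt.
Qed.

(** On spheres [s_{n-1} d_i x] is the base point, so that the tuple defining a
    homotopy from [x] to [y] consists of base points and the final entries [x]
    and [y]; it is the one that exhibits [x] as a composite of [y] with the base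
    point. *)
Lemma homotopic_composite x y : sphere x -> sphere y ->
  homotopic x y <-> composite y pt x.
Proof.
move=> sx sy.
have E i : i <= n.+2 -> htpy_tuple x y i = comp_tuple y pt x i.
  move=> le_i; rewrite /htpy_tuple /comp_tuple /=.
  case: ltngtP => [lt_i|lt_i|->].
  - by rewrite (ltn_eqF (leqW lt_i)) if_same sx ?degen_pt // ltnW.
  - by have -> : i = n.+2; [apply/eqP; rewrite eqn_leq le_i | rewrite eqxx].
  - by rewrite ltn_eqF.
split=> [[_]|fill_xy]; first exact: filled_ext.
split; first by move=> i le_i; rewrite sx ?sy.
by apply: filled_ext fill_xy => i le_i; rewrite E.
Qed.

(** The tetrahedron with two faces [x y], glued along the degenerate face
    [y 1 = y]. *)
Lemma composite_uniq x y z u : sphere y -> composite x y z -> composite x y u ->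
  composite u pt z.
Proof. move=> sy cz cu; exact: (tetra1 (compositex1 sy) cz cu). Qed.

Lemma composite_pt_sym x y : sphere y -> composite y pt x -> composite x pt y.
Proof.
move=> sy; apply: tetra1 (compositex1 _) (compositex1 sy).
exact: (sphere_pt K n.+1).
Qed.

Lemma composite_pt_trans x y z : composite x pt y -> composite y pt z ->
  composite x pt z.
Proof.
by move=> cxy cyz; apply: tetra2 (compositex1 (sphere_pt K n.+1)) cyz cxy.
Qed.

(** The three factors are exchanged one at a time.  First [z] is a composite of
    [x'] and [y]; then any composite [u] of [x'] and [y'] is homotopic to [z],
    hence to [z'], and [u] may be replaced by [z']. *)
Lemma composite_congr x x' y y' z z' :
    sphere x' -> sphere y -> sphere y' -> sphere z' ->
    composite x' pt x -> composite y' pt y -> composite z' pt z ->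
  composite x y z -> composite x' y' z'.
Proof.
move=> sx' sy sy' sz' cx cy cz c.
have [u su cu] := composite_ex sx' sy'.
have c' : composite x' y z := tetra2 (composite1x sy) c cx.
have cuz : composite u pt z := tetra1 cy c' cu.
have cuz' : composite u pt z' :=
  composite_pt_trans cuz (composite_pt_sym sz' cz).
exact: tetra2 (compositex1 sy') cuz' cu.
Qed.

End Composites.

Lemma homotopic_congr (K : pkan) n (x x' y y' z z' : K n.+1) :
    sphere x -> sphere y -> sphere x' -> sphere y' ->
    homotopic x x' -> homotopic y y' -> composite x y z -> composite x' y' z' ->
  homotopic z z'.
Proof.
move=> sx sy sx' sy' /(homotopic_composite sx sx') xx'.
move=> /(homotopic_composite sy sy') yy' c c'.
have sz := composite_sphere sx sy c; have sz' := composite_sphere sx' sy' c'.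
apply/homotopic_composite => //.
have cz := composite_congr sx' sy sy' sz xx' yy' (compositex1 sz) c.
exact: composite_uniq sy' cz c'.
Qed.

(** * Commutativity in dimension at least 2 *)

Lemma pad_cons_pt (K : pkan) n m (s : seq (K n)) :
  pad m (pt K n :: s) = pad m.+1 s.
Proof.
rewrite /pad; congr nth.
by elim: m => //= m ->.
Qed.

Section FourSimplex.
Variables (K : pkan) (n : nat).
Local Notation pt := (pt K n.+2).
Local Notation quad p q r s := (filled (pad n [:: p; q; r; s])).
Variables a012 a013 a014 a023 a024 a034 a123 a124 a134 a234 : K n.+2.

(* Row [i] lists the triangles of the face opposite to the vertex [i]. *)
Let triangles :=
  [:: [:: a234; a134; a124; a123]; [:: a234; a034; a024; a023];
      [:: a134; a034; a014; a013]; [:: a124; a024; a014; a012];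
      [:: a123; a023; a013; a012]].

Let trianglesE i j : i < j <= n.+4 - n ->
  nth pt (nth [::] triangles j) i = nth pt (nth [::] triangles i) j.-1.
Proof.
rewrite -addn4 addKn.
by case/andP; case: i j => [|[|[|[|i]]]] [|[|[|[|[|j]]]]].
Qed.

Lemma pentatope0 : quad a234 a034 a024 a023 -> quad a134 a034 a014 a013 ->
    quad a124 a024 a014 a012 -> quad a123 a023 a013 a012 ->
  quad a234 a134 a124 a123.
Proof.
move=> q1 q2 q3 q4; apply: (@filled_block _ _ n triangles 0) => //.
- by rewrite -addn4 leq_addr.
- by rewrite -addn4 addKn => -[|[|[|[|[|i]]]]].
Qed.

Lemma pentatope2 : quad a234 a134 a124 a123 -> quad a234 a034 a024 a023 ->
    quad a124 a024 a014 a012 -> quad a123 a023 a013 a012 ->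
  quad a134 a034 a014 a013.
Proof.
move=> q0 q1 q3 q4; apply: (@filled_block _ _ n triangles 2) => //.
- by rewrite -addn4 leq_addr.
- by rewrite -addn4 addKn.
- by rewrite -addn4 addKn => -[|[|[|[|[|i]]]]].
Qed.

End FourSimplex.

Section Commutativity.
Variables (K : pkan) (n : nat).
Local Notation pt := (pt K n.+2).
Local Notation quad p q r s := (filled (pad n [:: p; q; r; s])).

Lemma composite_quad (x y z : K n.+2) :
  composite x y z <-> quad pt y z x.
Proof. by rewrite pad_cons_pt; apply: composite_pad. Qed.

Lemma quad_degen (x : K n.+2) : sphere x -> quad x x pt pt.
Proof.
move=> sph_x; exists (degen n x) => i le_i.
rewrite padE; have [lt_in|le_ni] := ltnP i n.
  case: n x sph_x lt_in le_i => // m x sph_x lt_im le_i.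
  rewrite face_degen_lt ?lt_im ?(leqW (leqnSn _)) //.
  have le_im : i <= m.+2 by rewrite leqW // ltnW.
  by rewrite sph_x ?degen_pt // leqW.
move: le_i; rewrite -(subnKC le_ni) addKn.
case: (i - n) => [|[|[|[|d]]]] /=.
- by rewrite addn0 face_degen_eq // ltnW.
- by rewrite addn1 face_degen_succ // ltnW.
- by rewrite addn2 face_degen_gt ?leqnn ?leqnSn // sph_x // degen_pt // ltnW.
- by rewrite addn3 face_degen_gt ?leqnn ?leqnSn // sph_x // degen_pt // ltnW.
- by rewrite -[n.+3]addn3 leq_add2l.
Qed.

(** This filler for two unrelated spheres is where commutativity comes from: in
    a group written multiplicatively, such a row says that [p] and [x]
    commute. *)
Lemma quad_pair (p x : K n.+2) : sphere p -> sphere x -> quad p p x x.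
Proof.
move=> sp sx; have e : quad pt pt x x.
  by apply/composite_quad; apply: compositex1.
exact: (pentatope2 (quad_degen sp) (quad_degen sp) e e).
Qed.

(** In additive notation a filled row [(p, q, r, s)] means [p - q + r - s = 0];
    thus this row [(q, 0, x, y)] and the row [(0, q, y, x)] of the composite
    both say [q + x = y].  They are rows 2 and 4 of a 4-simplex whose rows 0, 1
    and 3 are [(0, q, q, 0)], [(0, 0, q, q)] and [(q, q, x, x)]. *)
Lemma quad_of_composite (q x y : K n.+2) : sphere q -> sphere x ->
  composite x q y -> quad q pt x y.
Proof.
move=> sq sx /composite_quad c.
apply: (pentatope2 _ _ (quad_pair sq sx) c).
- by apply/composite_quad; apply: composite1x.
- by apply/composite_quad; apply: compositex1.
Qed.

(** With 0 for the base point, the rows [(0, y, x, s)] and [(s, 0, y, x)] are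
    rows 0 and 4 of a 4-simplex whose rows 1, 2 and 3 are [(0, 0, 0, 0)],
    [(y, 0, 0, y)] and [(x, 0, 0, x)].  Whereas [quad_of_composite] obtains
    the row [(s, 0, y, x)] from a composite with second factor [s], this one
    has first factor [s]; the two together give commutativity. *)
Lemma composite_of_quad (s x y : K n.+2) : sphere x -> sphere y ->
  quad s pt y x -> composite s y x.
Proof.
move=> sx sy q; apply/composite_quad; apply: (pentatope0 _ _ _ q).
- by apply/composite_quad; apply: composite1x; apply: sphere_pt.
- by apply: quad_of_composite (composite1x sy) => //; apply: sphere_pt.
- by apply: quad_of_composite (composite1x sx) => //; apply: sphere_pt.
Qed.

Lemma composite_comm (x y z : K n.+2) : sphere x -> sphere y ->
  composite x y z -> composite y x z.
Proof.
move=> sx sy c; apply: composite_of_quad => //.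
  exact: composite_sphere c.
exact: quad_of_composite c.
Qed.

End Commutativity.

(** * Homotopy of spheres is an equivalence relation *)

Lemma homotopic0_pad (K : pkan) (x y : K 0) :
  homotopic x y <-> filled (pad 0 [:: x; y]).
Proof.
have E i : i <= 1 -> htpy_tuple x y i = pad 0 [:: x; y] i by case: i => [|[|i]].
split=> [[_]|fill]; first exact: filled_ext.
by split=> //; apply: filled_ext fill => i le_i; rewrite E.
Qed.

Lemma homotopic0_equiv (K : pkan) : Equivalence (@homotopic K 0).
Proof.
(* In dimension 0 the table of [filled_block] is that of a triangle: two of its
   edges give the third. *)
have row (v0 v1 v2 : K 0) k : k <= 2 ->
    let M := [:: [:: v2; v1]; [:: v2; v0]; [:: v1; v0]] in
    (forall i, i <= 2 -> i != k -> filled (pad 0 (nth [::] M i))) ->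
    filled (pad 0 (nth [::] M k)).
  move=> le_k M fillM; apply: (@filled_block K 0 0 M k) => // i j /andP[].
  by case: i j => [|[|[|i]]] [|[|[|j]]].
have refl (x : K 0) : filled (pad 0 [:: x; x]).
  exists (degen 0 x) => -[|[|i]] // _.
    by rewrite face_degen_eq.
  by rewrite face_degen_succ.
split=> [x|x y /homotopic0_pad xy|x y z /homotopic0_pad xy /homotopic0_pad yz];
  apply/homotopic0_pad => //.
- by apply: (row x y x 2) => // -[|[|[|i]]] // _ _; exact: refl.
- by apply: (row z y x 1) => // -[|[|[|i]]].
Qed.

Lemma sphere_htpy_equiv (K : pkan) n : Equivalence (@sphere_htpy K n).
Proof.
case: n => [|n].
  have [rf sm tr] := homotopic0_equiv K.
  by split=> [x|x y|x y z]; [apply: rf | apply: sm | apply: tr].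
split=> [[x sx]|[x sx] [y sy]|[x sx] [y sy] [z sz]]; rewrite /sphere_htpy /=.
- exact/homotopic_composite/compositex1.
- by move=> /(homotopic_composite sx sy)/(composite_pt_sym sy) c;
    apply/homotopic_composite.
- move=> /(homotopic_composite sx sy) cxy /(homotopic_composite sy sz) cyz.
  by apply/homotopic_composite => //; apply: composite_pt_trans cyz cxy.
Qed.

(** * Operations and maps on quotients *)

Section Quotient.
Variables (T : Type) (S : T -> Prop) (R : T -> T -> Prop).
Local Notation E := (fun x y : {x : T | S x} => R (sval x) (sval y)).
Hypothesis equivE : Equivalence E.

(** Unfolds to [pi_class] and [rel_pi_class] for the two kinds of spheres. *)
Definition cls x (hx : S x) : quot E := class E (exist _ x hx).

Lemma cls_eq x y (hx : S x) (hy : S y) : cls hx = cls hy <-> R x y.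
Proof.
have [rf sm tr] := equivE; split=> [[xy]|xy].
  have /= -> := congr1 (@^~ (exist _ y hy)) xy.
  exact: (rf (exist _ y hy)).
apply: eq_exist; apply/funext => z; apply/propext; split=> xz.
  by apply: tr xz; apply: sm.
exact: tr xz.
Qed.

Lemma cls_surj (a : quot E) : exists x (hx : S x), a = cls hx.
Proof.
case: a => A [[x hx] eA]; exists x, hx; exact: eq_exist.
Qed.

End Quotient.

Section Operation.
Variables (T : Type) (S : T -> Prop) (R : T -> T -> Prop).
Local Notation E := (fun x y : {x : T | S x} => R (sval x) (sval y)).
Variable C : T -> T -> T -> Prop.

(** Unfolds to [is_composition] and [is_rel_composition] for the two kinds of
    spheres. *)
Definition induced_op (op : quot E -> quot E -> quot E) :=
  forall x y z (hx : S x) (hy : S y), C x y z ->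
    exists hz : S z, op (cls R hx) (cls R hy) = cls R hz.

Hypothesis equivE : Equivalence E.
Hypothesis C_sphere : forall x y z, S x -> S y -> C x y z -> S z.
Hypothesis C_ex : forall x y, S x -> S y -> exists z, C x y z.

Lemma induced_opE op x y z (hx : S x) (hy : S y) (hz : S z) :
  induced_op op -> C x y z -> op (cls R hx) (cls R hy) = cls R hz.
Proof.
by move=> opP /(opP _ _ _ hx hy)[hz' ->]; rewrite (Prop_irrelevance hz' hz).
Qed.

Lemma induced_op_uniq :
    (forall x x' y y' z z', S x -> S y -> S x' -> S y' -> R x x' -> R y y' ->
       C x y z -> C x' y' z' -> R z z') ->
  exists! op, induced_op op.
Proof.
move=> C_congr.
have /choice[f fP] (ab : quot E * quot E) : exists c : quot E,
    forall x y z (hx : S x) (hy : S y) (hz : S z),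
      ab = (cls R hx, cls R hy) -> C x y z -> c = cls R hz.
  case: ab => a b; have [x [hx ->]] := cls_surj a.
  have [y [hy ->]] := cls_surj b; have [z xyz] := C_ex hx hy.
  have hz := C_sphere hx hy xyz.
  exists (cls R hz) => x' y' z' hx' hy' hz' eq_xy c.
  have /(cls_eq equivE) xx' := congr1 fst eq_xy.
  have /(cls_eq equivE) yy' := congr1 snd eq_xy.
  by apply/(cls_eq equivE); apply: C_congr xx' yy' xyz c.
exists (fun a b => f (a, b)); split=> [x y z hx hy c|op opP].
  by have hz := C_sphere hx hy c; exists hz; apply: fP c.
apply/funext => a; apply/funext => b.
have [x [hx ->]] := cls_surj a; have [y [hy ->]] := cls_surj b.
have [z xyz] := C_ex hx hy; have [hz ->] := opP _ _ _ hx hy xyz.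
exact: fP xyz.
Qed.

Lemma induced_op_group e op : S e ->
    (forall x, S x -> C e x x) -> (forall x, S x -> C x e x) ->
    (forall x, S x -> exists2 y, S y & C x y e) ->
    (forall x, S x -> exists2 y, S y & C y x e) ->
    (forall x y z u v w, S x -> S y -> S z -> C x y u -> C u z w -> C y z v ->
       C x v w) ->
  induced_op op -> is_group op.
Proof.
move=> he Ce1 C1e Crinv Clinv Cassoc opP.
pose one := cls R he.
have opA : associative op.
  move=> a b c; have [x [hx ->]] := cls_surj a; have [y [hy ->]] := cls_surj b.
  have [z [hz ->]] := cls_surj c.
  have [u xyu] := C_ex hx hy; have hu := C_sphere hx hy xyu.
  have [v yzv] := C_ex hy hz; have hv := C_sphere hy hz yzv.
  have [w uzw] := C_ex hu hz; have hw := C_sphere hu hz uzw.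
  rewrite (induced_opE hy hz hv opP yzv) (induced_opE hx hy hu opP xyu).
  rewrite (induced_opE hu hz hw opP uzw); apply: induced_opE => //.
  exact: Cassoc uzw yzv.
have op1 : left_id one op.
  move=> a; have [x [hx ->]] := cls_surj a.
  by apply: induced_opE => //; apply: Ce1.
have op1r : right_id one op.
  move=> a; have [x [hx ->]] := cls_surj a.
  by apply: induced_opE => //; apply: C1e.
have /choice[inv invP] (a : quot E) : exists b, op b a = one.
  have [x [hx ->]] := cls_surj a; have [y hy c] := Clinv x hx.
  by exists (cls R hy); apply: induced_opE.
have rinv (a : quot E) : exists b, op a b = one.
  have [x [hx ->]] := cls_surj a; have [y hy c] := Crinv x hx.
  by exists (cls R hy); apply: induced_opE.
exists one, inv; split=> // a.
have [b ab] := rinv a.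
by have -> : inv a = b by rewrite -[inv a]op1r -ab opA invP op1.
Qed.

Lemma induced_op_comm op :
    (forall x y z, S x -> S y -> C x y z -> C y x z) ->
  induced_op op -> commutative op.
Proof.
move=> Ccomm opP a b.
have [x [hx ->]] := cls_surj a; have [y [hy ->]] := cls_surj b.
have [z xyz] := C_ex hx hy; have hz := C_sphere hx hy xyz.
rewrite (induced_opE hx hy hz opP xyz); symmetry.
by apply: induced_opE => //; apply: Ccomm.
Qed.

End Operation.

Section Map.
Variables (T T' : Type) (S : T -> Prop) (S' : T' -> Prop).
Variables (R : T -> T -> Prop) (R' : T' -> T' -> Prop).
Local Notation E := (fun x y : {x : T | S x} => R (sval x) (sval y)).
Local Notation E' := (fun x y : {x : T' | S' x} => R' (sval x) (sval y)).
Variable f : T -> T'.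

(** Unfolds to [is_induced] and [is_rel_induced] for the two kinds of
    spheres. *)
Definition induced_map (F : quot E -> quot E') :=
  forall x (hx : S x), exists hfx : S' (f x), F (cls R hx) = cls R' hfx.

Lemma induced_map_uniq : Equivalence E -> Equivalence E' ->
    (forall x, S x -> S' (f x)) ->
    (forall x y, S x -> S y -> R x y -> R' (f x) (f y)) ->
  exists! F, induced_map F.
Proof.
move=> equivE equivE' fS fR.
have /choice[F FP] (a : quot E) : exists b : quot E',
    forall x (hx : S x), a = cls R hx -> b = cls R' (fS x hx).
  have [x [hx ->]] := cls_surj a; exists (cls R' (fS x hx)) => y hy.
  by move=> /(cls_eq equivE) xy; apply/(cls_eq equivE'); apply: fR.
exists F; split=> [x hx|G GP]; first by exists (fS x hx); apply: FP.
apply/funext => a; have [x [hx ->]] := cls_surj a.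
have [hfx ->] := GP x hx; rewrite (FP _ x hx) //.
by congr cls; apply: Prop_irrelevance.
Qed.

Lemma induced_map_morph (C : T -> T -> T -> Prop) (C' : T' -> T' -> T' -> Prop)
    F op op' :
    (forall x y, S x -> S y -> exists z, C x y z) ->
    (forall x y z, C x y z -> C' (f x) (f y) (f z)) ->
    induced_map F -> induced_op C op -> induced_op C' op' ->
  {morph F : a b / op a b >-> op' a b}.
Proof.
move=> C_ex fC FP opP op'P a b.
have [x [hx ->]] := cls_surj a; have [y [hy ->]] := cls_surj b.
have [z xyz] := C_ex x y hx hy; have [hz ->] := opP _ _ _ hx hy xyz.
have [hfx ->] := FP x hx; have [hfy ->] := FP y hy; have [hfz ->] := FP z hz.
by have [hfz' ->] := op'P _ _ _ hfx hfy (fC _ _ _ xyz); congr cls;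
  apply: Prop_irrelevance.
Qed.

End Map.

Lemma induced_map_id (T : Type) (S : T -> Prop) (R : T -> T -> Prop) :
  induced_map (S := S) (S' := S) (R := R) (R' := R) id id.
Proof. by move=> x hx; exists hx. Qed.

Lemma induced_map_comp (T T' T'' : Type) (S : T -> Prop) (S' : T' -> Prop)
    (S'' : T'' -> Prop) R R' R'' (f : T -> T') (g : T' -> T'')
    (F : quot _ -> quot _) (G : quot _ -> quot _) :
  induced_map (S := S) (S' := S') (R := R) (R' := R') f F ->
  induced_map (S := S') (S' := S'') (R := R') (R' := R'') g G ->
  induced_map (S := S) (S' := S'') (R := R) (R' := R'')
    (fun x => g (f x)) (G \o F).
Proof.
move=> FP GP x hx; have [hfx Fx] := FP x hx; have [hgfx Gx] := GP _ hfx.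
by exists hgfx; rewrite /= Fx.
Qed.

(** * Relative simplices as a Kan complex *)

Section Decalage.
Variable P : pkan_pair.

(** The face and degeneracy of index [i] will be those of index [i.+1] in
    [P]. *)
Definition dec n : Type := {x : P n.+1 | sub P (face 0 x)}.

Lemma dec_eq n (X Y : dec n) : sval X = sval Y -> X = Y.
Proof. by case: X Y => [x Lx] [y Ly] /= xy; apply: eq_exist. Qed.

Lemma sub_face n i (x : P n.+1) : i <= n.+1 -> sub P x -> sub P (face i x).
Proof. by case: (sub_subcomplex P) => subF _; apply: subF. Qed.

Lemma sub_degen n i (x : P n) : i <= n -> sub P x -> sub P (degen i x).
Proof. by case: (sub_subcomplex P) => _ subD; apply: subD. Qed.

(** The index is truncated because membership of the result in [dec] depends on
    it being in range, whereas faces must be defined for every index. *)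
Lemma dec_face_subproof n i (x : P n.+2) : sub P (face 0 x) ->
  sub P (face 0 (face (minn i n.+1).+1 x)).
Proof.
move=> Lx; rewrite face_face ?ltnS ?geq_minr //.
by apply: sub_face; rewrite ?geq_minr.
Qed.

Lemma dec_degen_subproof n i (x : P n.+1) : sub P (face 0 x) ->
  sub P (face 0 (degen (minn i n).+1 x)).
Proof.
move=> Lx; rewrite face_degen_lt ?ltnS ?geq_minr //.
by apply: sub_degen; rewrite ?geq_minr.
Qed.

Definition dec_face n i (X : dec n.+1) : dec n :=
  exist _ (face (minn i n.+1).+1 (sval X)) (dec_face_subproof i (svalP X)).

Definition dec_degen n i (X : dec n) : dec n.+1 :=
  exist _ (degen (minn i n).+1 (sval X)) (dec_degen_subproof i (svalP X)).

Lemma sval_dec_face n i (X : dec n.+1) : i <= n.+1 ->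
  sval (dec_face i X) = face i.+1 (sval X).
Proof. by move=> le_i; rewrite /= (minn_idPl le_i). Qed.

Lemma sval_dec_degen n i (X : dec n) : i <= n ->
  sval (dec_degen i X) = degen i.+1 (sval X).
Proof. by move=> le_i; rewrite /= (minn_idPl le_i). Qed.

Lemma dec_face_face n i j (X : dec n.+2) : i < j <= n.+2 ->
  dec_face i (dec_face j X) = dec_face j.-1 (dec_face i X).
Proof.
move=> /andP[lt_ij le_j]; have le_i : i <= n.+1 by exact: leq_trans lt_ij le_j.
case: j lt_ij le_j => // j lt_ij le_j; apply: dec_eq.
rewrite sval_dec_face // [RHS]sval_dec_face // !sval_dec_face ?(leqW le_i) //.
by rewrite face_face // ltnS lt_ij.
Qed.

Lemma dec_face_degen_lt n i j (X : dec n.+1) : i < j <= n.+1 ->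
  dec_face i (dec_degen j X) = dec_degen j.-1 (dec_face i X).
Proof.
move=> /andP[lt_ij le_j]; have le_i : i <= n by exact: leq_trans lt_ij le_j.
case: j lt_ij le_j => // j lt_ij le_j; apply: dec_eq.
rewrite sval_dec_face ?leqW // [RHS]sval_dec_degen // sval_dec_degen //.
by rewrite sval_dec_face ?leqW // face_degen_lt // ltnS lt_ij.
Qed.

Lemma dec_face_degen_eq n j (X : dec n) : j <= n ->
  dec_face j (dec_degen j X) = X.
Proof.
move=> le_j; apply: dec_eq.
by rewrite sval_dec_face ?leqW // sval_dec_degen // face_degen_eq.
Qed.

Lemma dec_face_degen_succ n j (X : dec n) : j <= n ->
  dec_face j.+1 (dec_degen j X) = X.
Proof.
move=> le_j; apply: dec_eq.
by rewrite sval_dec_face // sval_dec_degen // face_degen_succ.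
Qed.

Lemma dec_face_degen_gt n i j (X : dec n.+1) : j.+1 < i <= n.+2 ->
  dec_face i (dec_degen j X) = dec_degen j (dec_face i.-1 X).
Proof.
move=> /andP[lt_ji le_i]; have le_j : j <= n by exact: leq_trans lt_ji le_i.
case: i lt_ji le_i => // i lt_ji le_i; apply: dec_eq.
rewrite sval_dec_face // [RHS]sval_dec_degen // sval_dec_degen ?leqW //.
by rewrite sval_dec_face // face_degen_gt // ltnS lt_ji.
Qed.

Lemma dec_degen_degen n i j (X : dec n) : i <= j <= n ->
  dec_degen i (dec_degen j X) = dec_degen j.+1 (dec_degen i X).
Proof.
move=> /andP[le_ij le_j]; have le_i : i <= n by exact: leq_trans le_ij le_j.
apply: dec_eq.
rewrite sval_dec_degen ?leqW // [RHS]sval_dec_degen // !sval_dec_degen //.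
by rewrite degen_degen // ltnS le_ij.
Qed.

Definition dec_sset : sset :=
  SSet dec_face_face dec_face_degen_lt dec_face_degen_eq dec_face_degen_succ
    dec_face_degen_gt dec_degen_degen.

Definition cons_tuple n (h : P n) (t : nat -> P n) i :=
  if i is j.+1 then t j else h.

(** The 0-th faces of a horn form a horn in [L].  A filler of it in [L] is the
    missing 0-th entry of a horn in [K], a filler of which lies in the
    complex. *)
Lemma dec_kan : kan dec_sset.
Proof.
move=> n k t le_k _ horn_t.
have horn_d0 : is_horn k (fun i => face 0 (sval (t i))).
  case: n t le_k horn_t => // n t le_k horn_t i j /andP[lt_ij le_j] ne_i ne_j.
  have := congr1 sval (horn_t i j _ ne_i ne_j); rewrite lt_ij => /(_ le_j).
  have le_i : i <= n.+1 by exact: leq_trans lt_ij le_j.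
  have le_j1 : j.-1 <= n.+1 by case: (j) le_j.
  rewrite !sval_dec_face // => tE.
  have := @face_face P n 0 i.+1 (sval (t j)); rewrite ltnS => /(_ le_i) /= <-.
  have := @face_face P n 0 j.-1.+1 (sval (t i)).
  rewrite ltnS => /(_ le_j1) /= <-.
  by rewrite tE.
have [h Lh hE] := @sub_kan P n k _ le_k (fun i _ _ => svalP (t i)) horn_d0.
have horn_w : is_horn k.+1 (cons_tuple h (fun i => sval (t i))).
  move=> i j /andP[+ le_j].
  case: i j le_j => [|i] [|j] //= le_j lt_ij ne_i ne_j.
    by rewrite hE.
  case: j lt_ij le_j ne_j => // j lt_ij le_j ne_j.
  clear horn_d0; case: n t le_k horn_t h Lh hE le_j
    => [|n] t le_k horn_t h Lh hE le_j.
    (* The only pair of indices is (0, 1), one of which is the missing one. *)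
    by case: i j k le_k ne_i ne_j lt_ij le_j {horn_t hE}
      => [|i] [|j] [|[|k]].
  have lt_ij1 : i < j.+1 <= n.+2 by apply/andP.
  have := congr1 sval (horn_t i j.+1 lt_ij1 ne_i ne_j).
  have le_i : i <= n.+1 by apply: (@leq_trans j).
  by rewrite !sval_dec_face.
have [w _ wE] := pkan_kan (le_k : k.+1 <= n.+2) (fun _ _ _ => I) horn_w.
have Lw : sub P (face 0 w) by rewrite wE.
exists (exist _ w Lw : dec n.+1) => // i le_i ne_i; apply: dec_eq.
by rewrite sval_dec_face //= wE.
Qed.

Definition dec_base : dec_sset 0.
Proof.
exists (pt P 1); rewrite face_pt //; exact: sub_base.
Defined.

Definition dec_pkan : pkan := PKan dec_base dec_kan.

Lemma sval_dec_pt n : sval (pt dec_pkan n) = pt P n.+1.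
Proof.
by elim: n => // n IHn; rewrite [LHS]sval_dec_degen // IHn degen_pt.
Qed.

(** For [n = 0] the converse fails, since every vertex of [dec_pkan] is a
    sphere, whereas a relative sphere of dimension 1 starts at the base
    point. *)
Lemma sphere_dec n (X : dec_pkan n) : rel_sphere (sval X) -> sphere X.
Proof.
case: n X => // n X [_ sX] i le_i; apply: dec_eq.
by rewrite sval_dec_face // sval_dec_pt; apply: sX.
Qed.

Lemma rel_sphere_dec n (X : dec_pkan n.+1) : sphere X -> rel_sphere (sval X).
Proof.
move=> sX; split=> [|[|i] // /andP[_ le_i]]; first exact: (svalP X).
by have /(congr1 sval) := sX i le_i; rewrite sval_dec_face // sval_dec_pt.
Qed.

Lemma filled_dec n (T : nat -> dec_pkan n) (t : nat -> P n.+1) :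
    (forall i, i <= n.+1 -> t i.+1 = sval (T i)) -> sub P (t 0) ->
  filled t -> filled T.
Proof.
move=> tT L0 [w wE]; have Lw : sub P (face 0 w) by rewrite wE.
exists (exist _ w Lw : dec n.+1) => i le_i; apply: dec_eq.
by rewrite sval_dec_face //= wE // tT.
Qed.

Lemma dec_filled n (T : nat -> dec_pkan n) (t : P n.+1 -> nat -> P n.+1) :
    (forall h i, i <= n.+1 -> t h i.+1 = sval (T i)) -> (forall h, t h 0 = h) ->
  filled T -> exists2 h, sub P h & filled (t h).
Proof.
move=> tT t0 [W WE]; exists (face 0 (sval W)); first exact: (svalP W).
exists (sval W) => -[|i] le_i; first by rewrite t0.
by rewrite tT // -WE // sval_dec_face.
Qed.

Lemma htpy_tuple_dec n (h : P n.+1) (X Y : dec_pkan n) i : i <= n.+1 ->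
  rel_htpy_tuple h (sval X) (sval Y) i.+1 = sval (htpy_tuple X Y i).
Proof.
rewrite /rel_htpy_tuple /htpy_tuple ltnS eqSS /= => le_i.
case: ltngtP => // lt_i; case: n X lt_i {le_i Y h} => //= n X lt_i.
by rewrite (minn_idPl (ltnW lt_i)) minnn.
Qed.

(** For [n = 0] the condition [d_1 x = d_1 y] has no counterpart in [dec_pkan];
    it is part of the tuple being a cycle, which holds as the tuple is
    filled. *)
Lemma rel_homotopic_dec n (X Y : dec_pkan n) :
  rel_homotopic (sval X) (sval Y) <-> homotopic X Y.
Proof.
split=> [[dXY LX LY [h Lh [_ fill_h]]]|[dXY fillXY]].
  split; last first.
    apply: filled_dec fill_h => // i; exact: htpy_tuple_dec.
  case: n X Y dXY {fill_h h Lh LX LY} => // n X Y dXY i le_i; apply: dec_eq.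
  by rewrite !sval_dec_face // dXY.
have [h Lh fill_h] := @dec_filled _ (htpy_tuple X Y)
  (fun h => rel_htpy_tuple h (sval X) (sval Y))
  (fun h => @htpy_tuple_dec _ h X Y) (fun=> erefl) fillXY.
have cyc_h := filled_cycle fill_h.
split; [|exact: (svalP X)|exact: (svalP Y)|by exists h].
move=> i /andP[i_gt0 le_i]; case: n X Y dXY fillXY h Lh fill_h cyc_h le_i
  => [|n] X Y dXY _ h Lh _ cyc_h le_i.
  have := cyc_h 1 2 isT isT isT; rewrite /rel_htpy_tuple /htpy_tuple /= => dYX.
  by case: i i_gt0 le_i => [|[|i]].
case: i i_gt0 le_i => // i _ le_i.
by have /(congr1 sval) := dXY i le_i; rewrite !sval_dec_face.
Qed.

Lemma comp_tuple_dec n (h : P n.+1) (X Y Z : dec_pkan n) i :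
  rel_comp_tuple h (sval X) (sval Y) (sval Z) i.+1 = sval (comp_tuple X Y Z i).
Proof.
rewrite /rel_comp_tuple /comp_tuple !eqSS /= -/(pt P n.+1) -sval_dec_pt.
by case: ifP => // _; case: ifP => // _; case: ifP.
Qed.

Lemma composite_dec n (X Y Z : dec_pkan n.+1) : sphere Z ->
  rel_composite (sval X) (sval Y) (sval Z) <-> composite X Y Z.
Proof.
move=> sZ; split=> [[_ [h Lh fill_h]]|fillXYZ].
  by apply: filled_dec fill_h => // i _; apply: comp_tuple_dec.
split; first exact: rel_sphere_dec.
apply: (@dec_filled _ (comp_tuple X Y Z)
  (fun h => rel_comp_tuple h (sval X) (sval Y) (sval Z))) => //.
by move=> h i _; apply: comp_tuple_dec.
Qed.

End Decalage.

(** * Homotopy groups *)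

Section RelativeSpheres.
Variable P : pkan_pair.

Lemma rel_sphere_lift n (x : P n.+1) : rel_sphere x ->
  exists2 X : dec_pkan P n, sphere X & x = sval X.
Proof.
move=> sx; exists (exist _ x sx.1 : dec P n) => //.
by apply: sphere_dec; apply: sx.
Qed.

Lemma rel_sphere_htpy_equiv n : 1 <= n -> Equivalence (@rel_sphere_htpy P n).
Proof.
case: n => // n _; have [rf sm tr] := sphere_htpy_equiv (dec_pkan P) n.
split=> [[x sx]|[x sx] [y sy]|[x sx] [y sy] [z sz]];
  rewrite /rel_sphere_htpy /=; have [X sX ->] := rel_sphere_lift sx.
- apply/rel_homotopic_dec; exact: (rf (exist _ X sX)).
- have [Y sY ->] := rel_sphere_lift sy.
  move=> /rel_homotopic_dec XY; apply/rel_homotopic_dec.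
  exact: (sm (exist _ X sX) (exist _ Y sY)).
- have [Y sY ->] := rel_sphere_lift sy; have [Z sZ ->] := rel_sphere_lift sz.
  move=> /rel_homotopic_dec XY /rel_homotopic_dec YZ; apply/rel_homotopic_dec.
  exact: (tr (exist _ X sX) (exist _ Y sY) (exist _ Z sZ)).
Qed.

Lemma rel_composite_lift n (x y z : P n.+2) : rel_sphere x -> rel_sphere y ->
    rel_composite x y z ->
  exists X Y Z : dec_pkan P n.+1, [/\ sphere X, sphere Y, sphere Z &
    composite X Y Z] /\ [/\ x = sval X, y = sval Y & z = sval Z].
Proof.
move=> sx sy c; have sz := c.1.
have [X sX eX] := rel_sphere_lift sx; have [Y sY eY] := rel_sphere_lift sy.
have [Z sZ eZ] := rel_sphere_lift sz.
exists X, Y, Z; split; split=> //; apply/composite_dec => //.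
by rewrite -eX -eY -eZ.
Qed.

End RelativeSpheres.

Lemma composition_uniq (K : pkan) n : 1 <= n ->
  exists! op, @is_composition K n op.
Proof.
case: n => // n _; apply: induced_op_uniq.
- exact: sphere_htpy_equiv.
- by move=> x y z; apply: composite_sphere.
- by move=> x y sx sy; have [z] := composite_ex sx sy; exists z.
- exact: (@homotopic_congr K n).
Qed.

Lemma composition_group (K : pkan) n op : 1 <= n ->
  @is_composition K n op -> is_group op.
Proof.
case: n op => // n op _.
apply: (@induced_op_group _ (@sphere K n.+1) (@homotopic K n.+1)
  (@composite K n.+1) _ _ (pt K n.+1)).
- by move=> x y z; apply: composite_sphere.
- by move=> x y sx sy; have [z] := composite_ex sx sy; exists z.
- exact: sphere_pt.
- exact: composite1x.
- exact: compositex1.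
- exact: composite_rinv.
- exact: composite_linv.
- by move=> x y z u v w _ _ _ xy uz yz; exact: (tetra2 yz uz xy).
Qed.

Lemma composition_comm (K : pkan) n op : 2 <= n ->
  @is_composition K n op -> commutative op.
Proof.
case: n op => [|[|n]] // op _.
apply: (@induced_op_comm _ (@sphere K n.+2) (@homotopic K n.+2)
  (@composite K n.+2)).
- by move=> x y z; apply: composite_sphere.
- by move=> x y sx sy; have [z] := composite_ex sx sy; exists z.
- by move=> x y z; apply: composite_comm.
Qed.

Lemma rel_composite_ex (P : pkan_pair) n (x y : P n.+2) :
  rel_sphere x -> rel_sphere y -> exists z, rel_composite x y z.
Proof.
move=> /rel_sphere_lift[X sX ->] /rel_sphere_lift[Y sY ->].
have [Z sZ c] := composite_ex sX sY.
by exists (sval Z); apply/composite_dec.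
Qed.

Lemma rel_composition_uniq (P : pkan_pair) n : 2 <= n ->
  exists! op, @is_rel_composition P n op.
Proof.
case: n => [|[|n]] // _; apply: induced_op_uniq.
- exact: rel_sphere_htpy_equiv.
- by move=> x y z _ _ [].
- exact: rel_composite_ex.
move=> x x' y y' z z' sx sy sx' sy' xx' yy'.
move=> /(rel_composite_lift sx sy)[X [Y [Z [[sX sY sZ c] [eX eY eZ]]]]].
move=> /(rel_composite_lift sx' sy').
move=> [X' [Y' [Z' [[sX' sY' sZ' c'] [eX' eY' eZ']]]]].
move: xx' yy'; subst => /rel_homotopic_dec XX' /rel_homotopic_dec YY'.
apply/rel_homotopic_dec; exact: (homotopic_congr sX sY sX' sY' XX' YY' c c').
Qed.

Lemma rel_composition_group (P : pkan_pair) n op : 2 <= n ->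
  @is_rel_composition P n op -> is_group op.
Proof.
case: n op => [|[|n]] // op _; pose e := sval (pt (dec_pkan P) n.+1).
have se := sphere_pt (dec_pkan P) n.+1.
apply: (@induced_op_group _ (@rel_sphere P n.+2) (@rel_homotopic P n.+2)
  (@rel_composite P n.+2) _ _ e).
- by move=> x y z _ _ [].
- exact: rel_composite_ex.
- exact: rel_sphere_dec.
- move=> _ /rel_sphere_lift[X sX ->].
  by apply/composite_dec => //; apply: composite1x.
- move=> _ /rel_sphere_lift[X sX ->].
  by apply/composite_dec => //; apply: compositex1.
- move=> _ /rel_sphere_lift[X sX ->]; have [Y sY c] := composite_rinv sX.
  by exists (sval Y); [apply: rel_sphere_dec | apply/composite_dec].
- move=> _ /rel_sphere_lift[X sX ->]; have [Y sY c] := composite_linv sX.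
  by exists (sval Y); [apply: rel_sphere_dec | apply/composite_dec].
move=> x y z u v w sx sy sz xy uz yz.
have [X [Y [U [[sX sY sU cu] [ex ey eu]]]]] := rel_composite_lift sx sy xy.
have [Z sZ ez] := rel_sphere_lift sz.
have [V sV ev] := rel_sphere_lift yz.1; have [W sW ew] := rel_sphere_lift uz.1.
move: uz yz; subst => /(composite_dec _ _ sW) UZ /(composite_dec _ _ sV) YZ.
by apply/composite_dec => //; exact: (tetra2 YZ UZ cu).
Qed.

Lemma rel_composition_comm (P : pkan_pair) n op : 3 <= n ->
  @is_rel_composition P n op -> commutative op.
Proof.
case: n op => [|[|[|n]]] // op _.
apply: (@induced_op_comm _ (@rel_sphere P n.+3) (@rel_homotopic P n.+3)
  (@rel_composite P n.+3)).
- by move=> x y z _ _ [].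
- exact: rel_composite_ex.
move=> x y z sx sy.
move=> /(rel_composite_lift sx sy)[X [Y [Z [[sX sY sZ c] [-> -> ->]]]]].
by apply/composite_dec => //; apply: composite_comm.
Qed.

(** * Functoriality *)

Section Functoriality.
Variables (K K' : pkan) (f : pkan_map K K').

Lemma map_pt n : f n (pt K n) = pt K' n.
Proof.
elim: n => [|n IHn]; first exact: pkan_map_base.
by rewrite /= sfun_degen // IHn.
Qed.

Lemma map_filled n (t : nat -> K n) (u : nat -> K' n) :
  (forall i, i <= n.+1 -> f n (t i) = u i) -> filled t -> filled u.
Proof.
move=> tu [w wE]; exists (f n.+1 w) => i le_i.
by rewrite -sfun_face // wE // tu.
Qed.

Lemma map_sphere n (x : K n) : sphere x -> sphere (f n x).
Proof.
case: n x => // n x sx i le_i.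
by rewrite -sfun_face // sx // map_pt.
Qed.

Lemma map_htpy_tuple n (x y : K n) i :
  f n (htpy_tuple x y i) = htpy_tuple (f n x) (f n y) i.
Proof.
rewrite /htpy_tuple; case: ifP => [lt_i|_]; last by case: ifP.
case: n x {y} lt_i => //= n x lt_i.
by rewrite sfun_degen // sfun_face // ltnW.
Qed.

Lemma map_comp_tuple n (x y z : K n) i :
  f n (comp_tuple x y z i) = comp_tuple (f n x) (f n y) (f n z) i.
Proof.
rewrite /comp_tuple -map_pt.
by case: ifP => // _; case: ifP => // _; case: ifP.
Qed.

Lemma map_homotopic n (x y : K n) : homotopic x y -> homotopic (f n x) (f n y).
Proof.
move=> [dxy fill_xy]; split; last first.
  by apply: map_filled fill_xy => i _; apply: map_htpy_tuple.
case: n x y dxy {fill_xy} => // n x y dxy i le_i.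
by rewrite -!sfun_face // dxy.
Qed.

Lemma map_composite n (x y z : K n) :
  composite x y z -> composite (f n x) (f n y) (f n z).
Proof. by apply: map_filled => i _; apply: map_comp_tuple. Qed.

End Functoriality.

Section RelativeFunctoriality.
Variables (P P' : pkan_pair) (f : pair_map P P').

Lemma map_rel_sphere n (x : P n) : rel_sphere x -> rel_sphere (f n x).
Proof.
case: n x => // n x [Lx sx]; split=> [|i /andP[i_gt0 le_i]].
  by rewrite -sfun_face //; apply: pair_map_sub.
by rewrite -sfun_face // sx ?i_gt0 // map_pt.
Qed.

Lemma map_rel_homotopic n (x y : P n) :
  rel_homotopic x y -> rel_homotopic (f n x) (f n y).
Proof.
case: n x y => // n x y [dxy Lx Ly [h Lh [_ fill_h]]].
have fill_fh : filled (rel_htpy_tuple (f n.+1 h) (f n.+1 x) (f n.+1 y)).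
  apply: map_filled fill_h => i _; rewrite /rel_htpy_tuple.
  by case: ifP => // _; apply: map_htpy_tuple.
split.
- by move=> i /andP[i_gt0 le_i]; rewrite -!sfun_face // dxy // i_gt0.
- by rewrite -sfun_face //; apply: pair_map_sub.
- by rewrite -sfun_face //; apply: pair_map_sub.
- exists (f n.+1 h); first exact: pair_map_sub.
  by split=> //; apply: filled_cycle.
Qed.

Lemma map_rel_composite n (x y z : P n) :
  rel_composite x y z -> rel_composite (f n x) (f n y) (f n z).
Proof.
move=> [sz [h Lh fill_h]]; split; first exact: map_rel_sphere.
exists (f n h); first exact: pair_map_sub.
apply: map_filled fill_h => i _; rewrite /rel_comp_tuple.
by case: ifP => // _; apply: map_comp_tuple.
Qed.

End RelativeFunctoriality.

(** * The theorem *)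

Theorem mainTheorem2 :
  (* (a) *)
  ((forall (K : pkan) (n : nat), Equivalence (@sphere_htpy K n)) /\
   (forall (P : pkan_pair) (n : nat), 1 <= n ->
      Equivalence (@rel_sphere_htpy P n))) /\
  (* (b) *)
  ((forall (K : pkan) (n : nat), 1 <= n ->
      [/\ forall x y : K n, sphere x -> sphere y ->
            exists z : K n, composite x y z,
          exists! op, @is_composition K n op &
          forall op, @is_composition K n op -> is_group op]) /\
   (forall (P : pkan_pair) (n : nat), 2 <= n ->
      [/\ forall x y : P n, rel_sphere x -> rel_sphere y ->
            exists z : P n, rel_composite x y z,
          exists! op, @is_rel_composition P n op &
          forall op, @is_rel_composition P n op -> is_group op])) /\
  (* (c) *)
  ((forall (K : pkan) (n : nat), 2 <= n ->
      forall op, @is_composition K n op -> commutative op) /\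
   (forall (P : pkan_pair) (n : nat), 3 <= n ->
      forall op, @is_rel_composition P n op -> commutative op)) /\
  (* (d), absolute case *)
  [/\ forall (K K' : pkan) (f : pkan_map K K') (n : nat),
        exists! F, @is_induced K K' f n F,
      forall (K : pkan) (n : nat), @is_induced K K (pkan_id K) n id,
      forall (K K' K'' : pkan) (f : pkan_map K K') (g : pkan_map K' K'')
          (n : nat) F G,
        @is_induced K K' f n F -> @is_induced K' K'' g n G ->
        @is_induced K K'' (pkan_comp g f) n (G \o F) &
      forall (K K' : pkan) (f : pkan_map K K') (n : nat), 1 <= n ->
        forall F op op', @is_induced K K' f n F ->
          @is_composition K n op -> @is_composition K' n op' ->
          {morph F : a b / op a b >-> op' a b}] /\
  (* (d), relative case *)
  [/\ forall (P P' : pkan_pair) (f : pair_map P P') (n : nat), 1 <= n ->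
        exists! F, @is_rel_induced P P' f n F,
      forall (P : pkan_pair) (n : nat), 1 <= n ->
        @is_rel_induced P P (pair_id P) n id,
      forall (P P' P'' : pkan_pair) (f : pair_map P P') (g : pair_map P' P'')
          (n : nat) F G, 1 <= n ->
        @is_rel_induced P P' f n F -> @is_rel_induced P' P'' g n G ->
        @is_rel_induced P P'' (pair_comp g f) n (G \o F) &
      forall (P P' : pkan_pair) (f : pair_map P P') (n : nat), 2 <= n ->
        forall F op op', @is_rel_induced P P' f n F ->
          @is_rel_composition P n op -> @is_rel_composition P' n op' ->
          {morph F : a b / op a b >-> op' a b}].
Proof.
split; [split|split; [split|split; [split|split]]].
- exact: sphere_htpy_equiv.
- exact: rel_sphere_htpy_equiv.
- move=> K n n_gt0; split.
  + case: n n_gt0 => // n _ x y sx sy.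
    by have [z] := composite_ex sx sy; exists z.
  + exact: composition_uniq.
  + by move=> op; apply: composition_group.
- move=> P n n_gt1; split.
  + by case: n n_gt1 => [|[|n]] // _; apply: rel_composite_ex.
  + exact: rel_composition_uniq.
  + by move=> op; apply: rel_composition_group.
- by move=> K n n_gt1 op; apply: composition_comm.
- by move=> P n n_gt2 op; apply: rel_composition_comm.
- split=> [K K' f n|K n|K K' K'' f g n F G|K K' f n n_gt0 F op op' FP opP op'P].
  + apply: induced_map_uniq.
    * exact: sphere_htpy_equiv.
    * exact: sphere_htpy_equiv.
    * exact: map_sphere.
    * by move=> x y _ _; apply: map_homotopic.
  + exact: induced_map_id.
  + exact: induced_map_comp.
  + apply: (induced_map_morph _ _ FP opP op'P); last exact: map_composite.
    case: n n_gt0 {F op op' FP opP op'P} => // n _ x y sx sy.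
    by have [z] := composite_ex sx sy; exists z.
- split=> [P P' f n n_gt0|P n _|P P' P'' f g n F G _|
          P P' f n n_gt1 F op op' FP opP op'P].
  + apply: induced_map_uniq.
    * exact: rel_sphere_htpy_equiv.
    * exact: rel_sphere_htpy_equiv.
    * exact: map_rel_sphere.
    * by move=> x y _ _; apply: map_rel_homotopic.
  + exact: induced_map_id.
  + exact: induced_map_comp.
  + apply: (induced_map_morph _ _ FP opP op'P); last exact: map_rel_composite.
    case: n n_gt1 {F op op' FP opP op'P} => [|[|n]] // _.
    exact: rel_composite_ex.
Qed.
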